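(* Let $D\subseteq\mathbb{F}_2^n$ with $\overline 0\notin D$, $D\neq\emptyset$ and $D\ne\mathbb{F}_2^n\setminus\{\overline 0\}$, and let $k,\lambda,\mu$ be nonnegative integers with $\lambda\neq\mu$. Then $D$ is a partial difference set with parameters $(2^n,k,\lambda,\mu)$ if and only if $\chi_D$ (restricted to $\mathbb{F}_2^n\setminus\{\overline 0\}$) is a perfect coloring, with colors $0$ and $1$, of the subspace hypergraph $\mathcal{H}_n$ with the $3$-dimensional parameter matrix $S$ such that $$\begin{array}{ll} s_{0,0,0}=2^{n-1}-k+\mu/2-1; & s_{1,0,0}=2^{n-1}-k+\lambda/2;\\ s_{0,1,0}=s_{0,0,1}=\frac12(k-\mu); & s_{1,0,1}=s_{1,1,0}=\frac12(k-\lambda-1);\\ s_{0,1,1}=\mu/2; & s_{1,1,1}=\lambda/2. \end{array}$$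
   Context: $\overline 0$ is the zero vector; $\chi_D$ is the indicator function of $D$. A subset $D$ of a finite abelian group $G$ with $0\notin D$ is a partial difference set with parameters $(v,k,\lambda,\mu)$ if $|G|=v$, $|D|=k$, for every $x\in D$ there are exactly $\lambda$ ordered pairs $(y_1,y_2)\in D\times D$ with $y_1-y_2=x$, and for every nonzero $x\in G\setminus D$ there are exactly $\mu$ ordered pairs $(y_1,y_2)\in D\times D$ with $y_1-y_2=x$. The subspace hypergraph $\mathcal{H}_n$ is the $3$-uniform hypergraph with vertex set $\mathbb{F}_2^n\setminus\{\overline 0\}$ whose hyperedges are the $3$-element sets $\{x,y,z\}$ of vertices with $x+y+z=\overline 0$. A coloring of a hypergraph is a surjective function $f$ from the vertex set onto the set of colors. The color range of a hyperedge $e$ is the multiset $\{f(x):x\in e\}$. The coloring is perfect if any two vertices of the same color have the same multiset of color ranges of incident hyperedges; equivalently, for every color $i_1$ and color range $\{i_1,i_2,i_3\}$, the number $v_{i_1,\{i_1,i_2,i_3\}}$ of hyperedges with this color range incident to a vertex $x$ of color $i_1$ does not depend on the choice of $x$. The parameter matrix of a perfect coloring of a $3$-uniform hypergraph is $S=(s_{i_1,i_2,i_3})$ (indices ranging over colors) with $s_{i,j,j}=v_{i,\{i,j,j\}}$ and $s_{i,j,\ell}=\frac12 v_{i,\{i,j,\ell\}}$ for $j\ne\ell$. *)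

(* Defs.v *)
From mathcomp Require Import all_boot all_order all_algebra.
From mathcomp Require Import finmap multiset.

Set Implicit Arguments.
Unset Strict Implicit.
Unset Printing Implicit Defensive.

Import GRing.Theory.

Local Open Scope ring_scope.
Local Open Scope mset_scope.

Definition partial_difference_set (G : finZmodType) (D : {set G})
    (v k lambda mu : nat) : Prop :=
  let reps x := #|[set y : G * G | (y.1 \in D) && (y.2 \in D)
                                   && (y.1 - y.2 == x)]| in
  [/\ 0 \notin D, #|G| = v, #|D| = k,
      forall x, x \in D -> reps x = lambda
    & forall x, x != 0 -> x \notin D -> reps x = mu].

Definition hypergraph (V : finType) := {set {set V}}.

Section Coloring.

Variables (V : finType) (C : choiceType) (E : hypergraph V) (f : V -> C).

Definition coloring : Prop := forall c : C, exists x : V, f x = c.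

Definition color_range (e : {set V}) : {mset C} :=
  seq_mset [seq f x | x <- enum e].

Definition incident_color_ranges (x : V) : {mset {mset C}} :=
  seq_mset [seq color_range e | e <- enum [set e in E | x \in e]].

Definition perfect_coloring : Prop :=
  coloring /\
  forall x y, f x = f y -> incident_color_ranges x = incident_color_ranges y.

(* For perfect f, this depends on x only through f x; it is then the number
   v_{f x, r}. *)
Definition num_incident (x : V) (r : {mset C}) : nat :=
  #|[set e in E | (x \in e) && (color_range e == r)]|.

(* Entries are rational because of the factor 1/2.  The relation determines S
   when f is surjective.  Meaningful for 3-uniform E and perfect f. *)
Definition parameter_matrix (S : C -> C -> C -> rat) : Prop :=
  forall (x : V) (j l : C),
    S (f x) j l =
      if j == l then (num_incident x (seq_mset [:: f x; j; j]))%:R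
      else (num_incident x (seq_mset [:: f x; j; l]))%:R / 2.

End Coloring.

Definition nonzero_vector (n : nat) := {x : 'rV['F_2]_n | x != 0}.

Definition subspace_hypergraph (n : nat) : hypergraph (nonzero_vector n) :=
  [set e : {set nonzero_vector n} | (#|e| == 3%N)
                                    && (\sum_(x in e) val x == 0)].

(* The colors 0 and 1 are the two elements of 'I_2. *)
Definition indicator (n : nat) (D : {set 'rV['F_2]_n}) (x : nonzero_vector n)
    : 'I_2 :=
  if val x \in D then 1 else 0.

(* Main.v *)
Require Import Defs.
From mathcomp Require Import all_boot all_order all_algebra.
From mathcomp Require Import finmap multiset.
From mathcomp Require Import lra.

Set Implicit Arguments.
Unset Strict Implicit.
Unset Printing Implicit Defensive.

Import GRing.Theory Num.Theory.

Local Open Scope ring_scope.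

(** Over F_2 the hyperedges through a vertex x are the sets {x, y, z} with
    y + z = x, so each of them comes from exactly two ordered decompositions
    (y, z) of x.  For colors j and l, let N x j l be the number of
    decompositions of x whose first part has color j and second part color l.
    A hyperedge with color range {f x, j, l} accounts for two of the
    decompositions counted by N x j l if j = l, and for one in N x j l and one
    in N x l j otherwise.  In both cases the normalisation in the definition of
    the parameter matrix gives the same formula S (f x) j l = N x j l / 2
    ([parameter_matrixE]), and the coloring is perfect as soon as N x j l
    depends on x only through f x ([perfect_coloring_decompositions]).

    For the indicator of D, N x 1 1 is the number of representations of x as
    a difference of elements of D, because subtraction is addition here.  It
    determines the other entries: choosing y of a given color, distinct from x,
    fixes z, so N x j 0 + N x j 1 is the number of vertices of color j other
    than x, and N x 0 1 = N x 1 0 ([card_colored_decompositions_in],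
    [card_colored_decompositions_out]).  Hence if N x 1 1 is
    lambda on D and mu off D, then all of N depends on x only through its
    color, and the eight prescribed entries solve these linear equations with
    |D| = k.  Conversely S 0 1 1 and S 1 1 1 give mu and lambda,
    and then S 1 1 0 gives k. *)

(** * Vectors over F_2 and three-element multisets *)

Lemma addvv_F2 n (u : 'rV['F_2]_n) : u + u = 0.
Proof.
by apply/rowP=> i; rewrite !mxE; apply/addrr_pchar2/pchar_Fp.
Qed.

Lemma oppv_F2 n (u : 'rV['F_2]_n) : - u = u.
Proof. by apply/eqP; rewrite eq_sym -subr_eq0 opprK addvv_F2. Qed.

Lemma addv_eq0_F2 n (u v : 'rV['F_2]_n) : (u + v == 0) = (u == v).
Proof. by rewrite -{1}(oppv_F2 v) subr_eq0. Qed.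

Lemma addv_eq_F2 n (u v w : 'rV['F_2]_n) : (u + v == w) = (v == w + u).
Proof. by rewrite addrC -[X in _ + X]oppv_F2 subr_eq. Qed.

Lemma card_rV_F2 n : #|{: 'rV['F_2]_n}| = (2 ^ n)%N.
Proof. by rewrite card_mx card_Fp // mul1n. Qed.

Lemma seq_mset3_eq (C : choiceType) (i j l j' l' : C) :
  (seq_mset [:: i; j; l] == seq_mset [:: i; j'; l'])
  = ((j, l) == (j', l')) || ((j, l) == (l', j')).
Proof.
apply/eqP/idP => [/eq_seq_msetP|].
  rewrite perm_cons => /perm_consP[k [s [hk /perm_small_eq hs]]].
  rewrite !xpair_eqE.
  (* Up to rotation by k, the pair (j, l) is (j', l'). *)
  rewrite {s}hs // in hk.
  by case: k hk => [|[|k]] [-> ->]; rewrite !eqxx ?orbT.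
case/orP=> /eqP[-> ->] //; apply/eq_seq_msetP.
by rewrite perm_cons (perm_catC [:: _]).
Qed.

Lemma sum_I2 (F : 'I_2 -> nat) : (\sum_i F i = F 0%R + F 1%R)%N.
Proof.
by rewrite big_ord_recl big_ord1; congr (_ + F _)%N; apply: val_inj.
Qed.

(** * Hyperedges through a vertex as pairs of ordered decompositions *)

Section OrderedPairs.

Variables (n : nat) (C : finType) (f : nonzero_vector n -> C).
Implicit Types (x y z : nonzero_vector n) (e : {set nonzero_vector n}).

Definition decompositions x : {set nonzero_vector n * nonzero_vector n} :=
  [set p | val p.1 + val p.2 == val x].

Definition colored_decompositions x (j l : C) :=
  [set p in decompositions x | (f p.1 == j) && (f p.2 == l)].

Lemma decomposition_swap x y z :
  ((z, y) \in decompositions x) = ((y, z) \in decompositions x).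
Proof. by rewrite !inE addrC. Qed.

(** Two of the three vectors being equal would force the remaining one to
    vanish. *)
Lemma decomposition_uniq x y z :
  (y, z) \in decompositions x -> uniq [:: x; y; z].
Proof.
rewrite !inE /= => /eqP sum_yz; rewrite !inE negb_or andbT -andbA.
apply/and3P; split=> //; apply/eqP => eq_v.
- case/negP: (valP z); move: sum_yz; rewrite eq_v -{2}[val y]addr0.
  by move=> /addrI/eqP.
- case/negP: (valP y); move: sum_yz; rewrite eq_v -{2}[val z]add0r.
  by move=> /addIr/eqP.
- by have /negP[] := valP x; apply/eqP; rewrite -[LHS]sum_yz eq_v addvv_F2.
Qed.

Lemma decomposition_edge x y z :
  (y, z) \in decompositions x -> [set x; y; z] \in subspace_hypergraph n.
Proof.
move=> yz; have := decomposition_uniq yz.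
move: yz; rewrite inE /= => /eqP sum_yz.
rewrite /= !inE negb_or andbT => /andP[/andP[xy xz] ne_yz].
rewrite -setUA cardsU1 cards2 !inE negb_or xy xz ne_yz /=.
rewrite big_setU1 ?inE ?negb_or ?xy ?xz //= big_setU1 ?inE //= big_set1.
by rewrite sum_yz addvv_F2.
Qed.

Lemma edge_decomposition x e :
  e \in subspace_hypergraph n -> x \in e ->
  exists p, p \in decompositions x /\ e = [set x; p.1; p.2].
Proof.
rewrite inE => /andP[/eqP card_e sum_e] xe.
have /cards2P[y [z [ne_yz def_e]]] : #|e :\ x| == 2%N.
  by apply/eqP; rewrite (cardsD1 x) xe in card_e; case: card_e.
have {}def_e : e = [set x; y; z] by rewrite -(setD1K xe) def_e setUA.
exists (y, z); split=> //; move: sum_e card_e; rewrite {}def_e inE /=.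
rewrite -setUA cardsU1 cards2 ne_yz.
case nx: (x \notin _) => // sum_e _.
move: sum_e; rewrite big_setU1 //= big_setU1 ?inE //= big_set1.
by rewrite addv_eq0_F2 eq_sym.
Qed.

Lemma card_edge_decompositions x e :
  e \in subspace_hypergraph n -> x \in e ->
  #|[set p in decompositions x | [set x; p.1; p.2] == e]| = 2%N.
Proof.
move=> eE xe; have [[y z] [yz /= ->]] := edge_decomposition eE xe.
have u := decomposition_uniq yz.
have -> : [set p in decompositions x | [set x; p.1; p.2] == [set x; y; z]]
  = [set (y, z); (z, y)].
  apply/setP=> [[y' z']]; rewrite inE [RHS]inE !in_set1 /=.
  apply/andP/orP => [[yz' /eqP eq_e]|[] /eqP[-> ->]]; first last.
  - by rewrite decomposition_swap -!setUA (setUC [set z]).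
  - by [].
  have u' := decomposition_uniq yz'.
  have : perm_eq [:: x; y'; z'] [:: x; y; z].
    apply: uniq_perm => // v; have /setP/(_ v) := eq_e.
    by rewrite !inE -!orbA.
  by move/eq_seq_msetP/eqP; rewrite seq_mset3_eq => /orP[]; [left|right].
rewrite cards2 xpair_eqE negb_and.
by move: u; rewrite /= !inE => /and3P[_ -> _].
Qed.

(** Each hyperedge through x arises from two decompositions of x that differ
    by the order of their parts, and P does not see this order. *)
Lemma double_incident_edges x (P : pred {set nonzero_vector n}) :
  (#|[set e in subspace_hypergraph n | (x \in e) && P e]| * 2)%N
  = #|[set p in decompositions x | P [set x; p.1; p.2]]|.
Proof.
rewrite -[RHS]sum1_card.
rewrite (partition_big (fun p => [set x; p.1; p.2])
  (mem [set e in subspace_hypergraph n | (x \in e) && P e])) /=; last first.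
  move=> [y z]; rewrite [in X in X -> _]inE => /andP[yz Pe].
  by rewrite inE decomposition_edge //= Pe !inE eqxx.
rewrite -sum_nat_const; apply: eq_bigr => e; rewrite inE => /and3P[eE xe Pe].
apply: (etrans (esym (card_edge_decompositions eE xe))).
rewrite -sum1_card; apply: eq_bigl => p.
rewrite !inE; case: (_ == val x) => //=.
by case: eqP => [->|]; rewrite ?Pe ?andbF.
Qed.

Lemma color_range_decomposition x y z :
  (y, z) \in decompositions x ->
  color_range f [set x; y; z] = seq_mset [:: f x; f y; f z].
Proof.
move=> /decomposition_uniq u; apply/eq_seq_msetP.
apply: (perm_map f (t := [:: x; y; z])); apply: uniq_perm => [||v] //.
  exact: enum_uniq.
by rewrite mem_enum !inE -orbA.
Qed.

Lemma double_num_incident x r :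
  (num_incident (subspace_hypergraph n) f x r * 2)%N
  = #|[set p in decompositions x | seq_mset [:: f x; f p.1; f p.2] == r]|.
Proof.
rewrite double_incident_edges; congr #|pred_of_set _|; apply/setP=> -[y z].
rewrite inE [RHS]inE; case yz: (_ \in _) => //=.
by rewrite color_range_decomposition.
Qed.

Lemma card_colored_decompositionsC x j l :
  #|colored_decompositions x j l| = #|colored_decompositions x l j|.
Proof.
pose swap (p : nonzero_vector n * nonzero_vector n) := (p.2, p.1).
have swapK : involutive swap by case.
rewrite -(card_imset _ (inv_inj swapK)); congr #|pred_of_set _|.
apply/setP=> -[y z]; rewrite (can_imset_pre _ swapK) !inE /=.
by rewrite addrC (andbC (f z == j)).
Qed.

(** The factor 1/2 that the parameter matrix puts on its entries with j <> l
    only is what makes this uniform: for j = l the factor comes from the two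
    orderings of a hyperedge, while for j <> l the two orderings lie in
    different classes of decompositions. *)
Lemma parameter_matrixE (S : C -> C -> C -> rat) :
  parameter_matrix (subspace_hypergraph n) f S <->
  forall x j l, S (f x) j l = #|colored_decompositions x j l|%:R / 2.
Proof.
suff num x j l :
    (if j == l
     then (num_incident (subspace_hypergraph n) f x (seq_mset [:: f x; j; j]))%:R
     else (num_incident (subspace_hypergraph n) f x (seq_mset [:: f x; j; l]))%:R
          / 2)
    = #|colored_decompositions x j l|%:R / 2 :> rat.
  by split=> hS x j l; rewrite hS num.
have : (num_incident (subspace_hypergraph n) f x (seq_mset [:: f x; j; l]) * 2)%N
  = #|colored_decompositions x j l :|: colored_decompositions x l j|.
  rewrite double_num_incident; congr #|pred_of_set _|; apply/setP=> p.
  by rewrite !inE seq_mset3_eq !xpair_eqE andb_orr.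
case: eqP => [<-|/eqP ne_jl].
  by rewrite setUid => <-; rewrite natrM mulfK.
rewrite cardsU disjoint_setI0 ?cards0 ?subn0; last first.
  rewrite -setI_eq0; apply/eqP/setP=> p; rewrite !inE.
  apply/negP=> /andP[/andP[_ /andP[/eqP -> _]] /andP[_ /andP[jl _]]].
  by rewrite jl in ne_jl.
rewrite (card_colored_decompositionsC x l j) addnn -muln2 => /eqP.
by rewrite eqn_pmul2r // => /eqP ->.
Qed.

(** Every incidence number is a combination of numbers of colored
    decompositions with coefficients that depend on x only through its color;
    this is what makes the latter control perfection of the coloring. *)
Lemma num_incidentE x r :
  (num_incident (subspace_hypergraph n) f x r * 2)%N
  = (\sum_(q : C * C | seq_mset [:: f x; q.1; q.2] == r)
       #|colored_decompositions x q.1 q.2|)%N.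
Proof.
rewrite double_num_incident -sum1_card.
rewrite (partition_big (fun p => (f p.1, f p.2))
  (fun q : C * C => seq_mset [:: f x; q.1; q.2] == r)) /=; last first.
  by move=> p; rewrite inE => /andP[].
apply: eq_bigr => -[j l] /= r_jl; rewrite -sum1_card; apply: eq_bigl => p.
rewrite !inE xpair_eqE; case: (_ == val x) => //=.
case: (f p.1 =P j) => [->|]; last by rewrite andbF.
by case: (f p.2 =P l) => [->|]; rewrite ?r_jl ?andbF.
Qed.

Lemma incident_color_rangesE x r :
  incident_color_ranges (subspace_hypergraph n) f x r
  = num_incident (subspace_hypergraph n) f x r.
Proof.
rewrite mset_seqE count_map /num_incident cardE -size_filter.
apply/perm_size/uniq_perm => [||e].
- exact/filter_uniq/enum_uniq.
- exact: enum_uniq.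
by rewrite mem_filter !mem_enum !inE [RHS]andbA [RHS]andbC.
Qed.

Lemma perfect_coloring_decompositions :
  coloring f ->
  (forall x y j l, f x = f y ->
     #|colored_decompositions x j l| = #|colored_decompositions y j l|) ->
  perfect_coloring (subspace_hypergraph n) f.
Proof.
move=> f_onto eq_dec; split=> // x y eq_f; apply/msetP=> r.
rewrite !incident_color_rangesE; apply/eqP.
rewrite -(eqn_pmul2r (isT : 0 < 2)%N) !num_incidentE eq_f; apply/eqP.
by apply: eq_bigr => q _; apply: eq_dec.
Qed.

(** A decomposition is determined by its first part, which can be any vertex
    other than x. *)
Lemma sum_colored_decompositions x j :
  (\sum_l #|colored_decompositions x j l| + (f x == j) = #|[set y | f y == j]|)%N.
Proof.
have -> : (\sum_l #|colored_decompositions x j l|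
  = #|[set p in decompositions x | f p.1 == j]|)%N.
  rewrite -[RHS]sum1_card (partition_big (fun p => f p.2) predT) //=.
  apply: eq_bigr => l _; rewrite -sum1_card; apply: eq_bigl => p.
  by rewrite !inE andbA.
rewrite (cardsD1 x) inE addnC; congr addn.
have inj : {in [set p in decompositions x | f p.1 == j] &, injective fst}.
  move=> [y z] [y' z']; rewrite !inE /= => /andP[h _] /andP[h' _] eq_y.
  move: h h'; rewrite -eq_y !addv_eq_F2 => /eqP h /eqP h'.
  by congr pair; apply: val_inj; rewrite /= h.
rewrite -(card_in_imset inj); congr #|pred_of_set _|.
apply/setP=> y; rewrite !inE; apply/imsetP/andP.
  case=> -[y' z]; rewrite inE => /andP[yz fy] -> /=; split=> //.
  have := decomposition_uniq yz.
  by rewrite /= !inE negb_or eq_sym => /andP[/andP[]].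
move=> [ne_yx fy].
have nz : val x + val y != 0 by rewrite addv_eq0_F2 eq_sym.
by exists (y, Sub (val x + val y) nz); rewrite // !inE /= addv_eq_F2 eqxx.
Qed.

End OrderedPairs.

(** * Decompositions colored by membership in a set *)

Section Indicator.

Variables (n : nat) (D : {set 'rV['F_2]_n}).
Hypothesis D0 : 0 \notin D.

Let f := @indicator n D.

Lemma indicator_eq1 x : (f x == 1) = (val x \in D).
Proof. by rewrite /f /indicator; case: ifP. Qed.

Lemma indicator_eq0 x : (f x == 0) = (val x \notin D).
Proof. by rewrite /f /indicator; case: ifP. Qed.

(** The elements of D are vertices because 0 is not in D, and differences are
    sums in characteristic 2. *)
Lemma card_colored_decompositions11 x :
  #|colored_decompositions f x 1 1|
  = #|[set y : 'rV['F_2]_n * 'rV['F_2]_n |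
        (y.1 \in D) && (y.2 \in D) && (y.1 - y.2 == val x)]|.
Proof.
have inj : injective (fun p : nonzero_vector n * nonzero_vector n =>
                        (val p.1, val p.2)).
  by move=> [y z] [y' z'] /= [] /val_inj -> /val_inj ->.
rewrite -(card_imset _ inj); congr #|pred_of_set _|; apply/setP=> -[u v].
rewrite inE /=; apply/imsetP/andP.
  case=> -[y z]; rewrite !inE !indicator_eq1 => /and3P[h yD zD] [-> ->] /=.
  by rewrite oppv_F2 h yD zD.
rewrite oppv_F2 => -[/andP[uD vD] h].
have u0 : u != 0 by apply: contraNneq D0 => <-.
have v0 : v != 0 by apply: contraNneq D0 => <-.
by exists (Sub u u0, Sub v v0); rewrite // !inE !indicator_eq1 /= h uD vD.
Qed.

Lemma card_indicator1 : #|[set y | f y == 1]| = #|D|.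
Proof.
rewrite -(card_imset _ val_inj); congr #|pred_of_set _|; apply/setP=> u.
apply/imsetP/idP => [[y]|uD]; first by rewrite inE indicator_eq1 => yD ->.
have u0 : u != 0 by apply: contraNneq D0 => <-.
by exists (Sub u u0); rewrite // inE indicator_eq1.
Qed.

Lemma card_indicator0 : (#|[set y | (f y == 0)%R]| + #|D| + 1 = 2 ^ n)%N.
Proof.
rewrite -card_indicator1.
have -> : [set y | f y == 0] = ~: [set y | f y == 1].
  by apply/setP=> y; rewrite !inE indicator_eq0 indicator_eq1.
rewrite [addn #|~: _| _]addnC cardsC -card_rV_F2 card_sig.
rewrite -(cardC (pred1 (0 : 'rV['F_2]_n))) card1 addnC; congr addn.
Qed.

Lemma card_colored_decompositions_in x :
  (#|colored_decompositions f x 1%R 0%R| + #|colored_decompositions f x 1%R 1%R|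
   + (f x == 1)%R = #|D|)%N.
Proof.
by rewrite -card_indicator1 -(sum_colored_decompositions f x) sum_I2.
Qed.

Lemma card_colored_decompositions_out x :
  (#|colored_decompositions f x 0%R 0%R| + #|colored_decompositions f x 0%R 1%R|
   + (f x == 0)%R + #|D| + 1 = 2 ^ n)%N.
Proof.
by rewrite -card_indicator0 -(sum_colored_decompositions f x) sum_I2.
Qed.

End Indicator.

(** * Partial difference sets and perfect colorings *)

Theorem theorem5 (n : nat) (D : {set 'rV['F_2]_n}) (k lambda mu : nat) :
  0 \notin D -> D <> set0 -> D <> [set~ 0] -> lambda <> mu ->
  partial_difference_set D (2 ^ n)%N k lambda mu
  <->
  exists S : 'I_2 -> 'I_2 -> 'I_2 -> rat,
    perfect_coloring (subspace_hypergraph n) (@indicator n D)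
    /\ parameter_matrix (subspace_hypergraph n) (@indicator n D) S
    /\ S 0 0 0 = 2 ^+ n.-1 - k%:R + mu%:R / 2 - 1
    /\ S 1 0 0 = 2 ^+ n.-1 - k%:R + lambda%:R / 2
    /\ S 0 1 0 = (k%:R - mu%:R) / 2
    /\ S 0 0 1 = (k%:R - mu%:R) / 2
    /\ S 1 0 1 = (k%:R - lambda%:R - 1) / 2
    /\ S 1 1 0 = (k%:R - lambda%:R - 1) / 2
    /\ S 0 1 1 = mu%:R / 2
    /\ S 1 1 1 = lambda%:R / 2.
Proof.
move=> D0 Dn0 DnT _; set f := @indicator n D.
have [x1 fx1] : exists x, f x = 1.
  have /set0Pn[u uD] : D != set0 by apply/eqP.
  have u0 : u != 0 by apply: contraNneq D0 => <-.
  by exists (Sub u u0); apply/eqP; rewrite indicator_eq1.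
have [x0 fx0] : exists x, f x = 0.
  have [u u0 uD] : exists2 u, u != 0 & u \notin D.
    apply/exists_inP; apply: contra_notT DnT => /exists_inPn h.
    apply/setP=> u; rewrite !inE; apply/idP/idP => [|/h]; last by rewrite negbK.
    by apply: contraTneq => ->.
  by exists (Sub u u0); apply/eqP; rewrite indicator_eq0.
have f_cases x : f x = 0 \/ f x = 1.
  by rewrite /f /indicator; case: ifP; [right|left].
have I2_cases (j : 'I_2) : j = 0 \/ j = 1.
  by case: j => [[|[|]]] // h; [left|right]; apply: val_inj.
pose N x j l : rat := #|colored_decompositions f x j l|%:R.
have NC x : N x 0 1 = N x 1 0 by rewrite /N card_colored_decompositionsC.
have N1 x : N x 1 0 + N x 1 1 + (f x == 1)%:R = #|D|%:R.
  by rewrite /N -!natrD card_colored_decompositions_in.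
have N0 x : N x 0 0 + N x 0 1 + (f x == 0)%:R + #|D|%:R + 1 = 2 * 2 ^+ n.-1.
  (* In dimension 0 the only subset avoiding 0 is empty, so n.-1 is no
     truncated subtraction. *)
  have n_gt0 : (0 < n)%N.
    case: n D D0 Dn0 {DnT f x1 x0 fx1 fx0 f_cases N NC N1 x} => // D D0 [].
    apply/setP=> u; rewrite inE; apply/negbTE.
    by rewrite (_ : u = 0) //; apply/rowP=> -[].
  rewrite -exprS prednK // -natrX -(card_colored_decompositions_out D0 x).
  by rewrite /N -/f !natrD.
have N11 x : N x 1 1 = #|[set y : 'rV['F_2]_n * 'rV['F_2]_n |
        (y.1 \in D) && (y.2 \in D) && (y.1 - y.2 == val x)]|%:R.
  by rewrite /N card_colored_decompositions11.
split=> [[_ _ cardD lamD muD]|[S [_ [/parameter_matrixE hS]]]].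
- have N11_1 x : f x = 1 -> N x 1 1 = lambda%:R.
    by move=> /eqP; rewrite indicator_eq1 N11 => /lamD ->.
  have N11_0 x : f x = 0 -> N x 1 1 = mu%:R.
    by move=> /eqP; rewrite indicator_eq0 N11 => /muD -> //; exact: (valP x).
  (* N x 1 1 and the relations N1, N0 and NC form a linear system that
     determines N x from the color of x. *)
  have eqN x y j l : f x = f y -> N x j l = N y j l.
    move=> eq_f; have {}N11 : N x 1 1 = N y 1 1.
      have fy := esym eq_f; case: (f_cases x) => fx; rewrite fx in fy.
        by rewrite !N11_0.
      by rewrite !N11_1.
    have := NC x; have := NC y; have := N1 x; have := N1 y; have := N0 x.
    have := N0 y; rewrite eq_f.
    by case: (I2_cases j) (I2_cases l) => -> [] -> *; lra.
  (* Any representative of each color yields the same matrix, by eqN. *)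
  exists (fun i j l => N (if i == 1 then x1 else x0) j l / 2).
  split.
    apply: perfect_coloring_decompositions => [c|x y j l /eqN-/(_ j l)/eqP].
      by case: (I2_cases c) => ->; [exists x0|exists x1].
    by rewrite eqr_nat => /eqP.
  split.
    apply/parameter_matrixE => x j l; congr (_ / _); apply: eqN.
    by case: (f_cases x) => ->; rewrite ?eqxx.
  rewrite -cardD /=.
  have := N0 x0; have := N0 x1; have := N1 x0; have := N1 x1.
  have := NC x0; have := NC x1.
  rewrite (N11_0 x0) // (N11_1 x1) // fx0 fx1 /= => *; do !split; lra.
- move=> [_ [_ [_ [_ [_ [S110 [S011 S111]]]]]]].
  have two_inj (a b : nat) : a%:R / 2 = b%:R / 2 :> rat -> a = b.
    by move=> h; apply/eqP; rewrite -(eqr_nat rat); apply/eqP; lra.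
  split=> [|||x xD|x nx0 xD] //.
  + exact: card_rV_F2.
  + have := N1 x1; rewrite fx1 eqxx => h.
    have := hS x1 1 0; have := hS x1 1 1; rewrite fx1 S110 S111 -!/(N _ _ _).
    move=> h11 h10; apply/eqP; rewrite -(eqr_nat rat); apply/eqP.
    by move: h h10 h11 => /= *; lra.
  + have nx0 : x != 0 by apply: contraNneq D0 => <-.
    have fx : f (Sub x nx0) = 1 by apply/eqP; rewrite indicator_eq1.
    apply: two_inj; rewrite -S111 -fx hS; congr (_ / _); symmetry.
    by rewrite fx; apply: N11.
  + have fx : f (Sub x nx0) = 0 by apply/eqP; rewrite indicator_eq0.
    apply: two_inj; rewrite -S011 -{1}fx hS; congr (_ / _); symmetry.
    exact: N11.
Qed.
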